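(* Let $n \geq 0$ be an integer. Then the identity $\tau(\mathrm{ImP}_2(n)) = A258472(n)$ holds if and only if the map $\mathrm{pre}_2$ is injective on $\mathcal{P}_2(n)$.
   Context: A partition of a non-negative integer $n$ is a weakly decreasing finite sequence $\lambda = (\lambda_1 \geq \cdots \geq \lambda_\ell)$ of positive integers (its parts) with sum $n$; its length is $\ell(\lambda) = \ell$, and one writes $\lambda \vdash n$. The empty sequence is the unique partition of $0$. For a partition $\lambda$ with $\ell(\lambda) \geq 2$, $\mathrm{pre}_2(\lambda)$ is the partition whose multiset of parts consists of all products $\lambda_{i} \lambda_{j}$ over all pairs of indices $1 \leq i < j \leq \ell(\lambda)$ (one part for each pair of indices). $\mathcal{P}_2(n)$ is the set of all partitions of $n$ with at least $2$ parts, and $\mathrm{ImP}_2(n) = \mathrm{pre}_2(\mathcal{P}_2(n))$ is the image, regarded as a set of partitions. For a set $S$ of partitions, $\tau(S) = \sum_{\mu \in S} \ell(\mu)$ is the total number of parts, counted with multiplicity, of the partitions in $S$. $A258472(n)$ is the OEIS sequence counting partitions of $n$ into two sorts of parts with exactly two parts of the second sort, i.e. the number of pairs $(\lambda, T)$ where $\lambda \vdash n$ and $T$ is a $2$-element subset of the index positions $\{1, \dots, \ell(\lambda)\}$. *)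

(* Defs.v *)
From HB Require Import structures.
From mathcomp Require Import all_boot finmap.

Set Implicit Arguments.
Unset Strict Implicit.
Unset Printing Implicit Defensive.

Local Open Scope fset_scope.

Definition is_intpart (s : seq nat) : bool := sorted geq s && (0 \notin s).

Record intpart := IntPart {parts :> seq nat; _ : is_intpart parts}.

HB.instance Definition _ := [isSub for parts].
HB.instance Definition _ := [Countable of intpart by <:].

Definition len (lam : intpart) : nat := size lam.

Fixpoint bounded_seqs (m k : nat) : seq (seq nat) :=
  if k is k'.+1 then
    [::] :: [seq i :: s | i <- iota 1 m, s <- bounded_seqs m k']
  else [:: [::]].

(* A partition of n has at most n parts, each at most n, so the finite
   enumeration loses nothing: see [mem_partitions]. *)
Definition partitions (n : nat) : {fset intpart} :=
  [fset lam in pmap insub (bounded_seqs n n) | sumn (parts lam) == n].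

Lemma mem_bounded_seqs m k s :
  size s <= k -> all (fun i => 0 < i <= m) s -> s \in bounded_seqs m k.
Proof.
elim: k s => [|k IHk] [|i s] //= sz_s /andP[i_m s_m].
rewrite inE /=; apply/allpairsP; exists (i, s); split=> //=.
  by rewrite mem_iota add1n ltnS.
exact: IHk.
Qed.

Lemma mem_partitions n (lam : intpart) :
  (lam \in partitions n) = (sumn (parts lam) == n).
Proof.
rewrite !inE /=; apply: andb_idl => /eqP <-.
rewrite mem_pmap_sub /=; case: lam => s /= /andP[_ s_pos].
have {}s_pos i : i \in s -> 0 < i.
  by case: i => // s0; rewrite s0 in s_pos.
apply: mem_bounded_seqs; last first.
  apply/allP => i s_i; rewrite s_pos //= sumnE.
  by rewrite (big_rem i) //= leq_addr.
elim: s s_pos => //= i s IHs s_pos; rewrite -add1n leq_add //.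
  by apply: s_pos; rewrite mem_head.
by apply: IHs => j s_j; apply: s_pos; rewrite inE s_j orbT.
Qed.

(* One product per pair of positions i < j < size s, multiplicities kept. *)
Definition pair_products (s : seq nat) : seq nat :=
  [seq nth 0 s i * nth 0 s j | j <- iota 0 (size s), i <- iota 0 j].

Lemma pre2_subproof (lam : intpart) :
  is_intpart (sort geq (pair_products lam)).
Proof.
have geq_total : total geq by move=> x y; exact: leq_total.
rewrite /is_intpart (sort_sorted geq_total) /= mem_sort.
case: lam => s /= /andP[_ s0].
apply/negP => /allpairsPdep[j [i [+ + /esym/eqP]]].
rewrite !mem_iota !add0n /= => lt_j lt_i.
rewrite muln_eq0 => /orP[] /eqP sE; move: s0; rewrite -sE mem_nth //.
exact: ltn_trans lt_i lt_j.
Qed.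

(* Total on partitions: the value is the empty partition when lam has fewer
   than two parts. *)
Definition pre2 (lam : intpart) : intpart := IntPart (pre2_subproof lam).

Definition P2 (n : nat) : {fset intpart} :=
  [fset lam in partitions n | 2 <= len lam].

Definition ImP2 (n : nat) : {fset intpart} := [fset pre2 lam | lam in P2 n].

Definition tau (S : {fset intpart}) : nat := \sum_(mu <- S) len mu.

Definition positions (lam : intpart) : {fset nat} :=
  [fset i in iota 1 (len lam)].

Definition two_subsets (A : {fset nat}) : {fset {fset nat}} :=
  [fset T in fpowerset A | #|` T| == 2].

Definition marked_partitions (n : nat) : {fset intpart * {fset nat}} :=
  [fset (lam, T) | lam : intpart in partitions n,
                   T : {fset nat} in two_subsets (positions lam)].

Definition A258472 (n : nat) : nat := #|` marked_partitions n|.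

(* Main.v *)
Require Import Defs.
From mathcomp Require Import all_boot finmap.

(** Both sides of the identity are sums of one weight.  A marking of a
    partition lam chooses a pair of positions of lam, and [pre2 lam] has exactly
    one part per such pair, so the marked partitions of n number the sum of
    [len (pre2 lam)] over all lam in [P2 n] ([A258472_sum_len_pre2]; partitions
    with fewer than two parts have no marking).  The total number of parts in
    [ImP2 n] is the sum of the same weight with each fibre of [pre2] counted
    only once.  As the weight is positive on [P2 n], nothing is lost precisely
    when no fibre has two elements ([sum_imfset_eqP]). *)

Set Implicit Arguments.
Unset Strict Implicit.
Unset Printing Implicit Defensive.

Local Open Scope fset_scope.

(** The sum over S splits along the fibres of f, and each fibre over y in the
    image contributes w y at least once. *)
Lemma leq_sum_imfset (I J : choiceType) (f : I -> J) (w : J -> nat)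
    (S : {fset I}) :
  \sum_(y <- [fset f x | x in S]) w y <= \sum_(x <- S) w (f x).
Proof.
rewrite (partition_big_imfset _ f S) big_seq [X in _ <= X]big_seq.
apply: leq_sum => y /imfsetP[x /= Sx ->].
by rewrite big_mkcond (big_fsetD1 x) //= eqxx leq_addr.
Qed.

(** If f identifies two distinct points of S, deleting one of them leaves the
    image unchanged but removes a positive term from the sum over S. *)
Lemma sum_imfset_eqP (I J : choiceType) (f : I -> J) (w : J -> nat)
    (S : {fset I}) :
  {in S, forall x, 0 < w (f x)} ->
  \sum_(y <- [fset f x | x in S]) w y = \sum_(x <- S) w (f x) <->
  {in S &, injective f}.
Proof.
move=> w_gt0; split=> [eq_sum x x' Sx Sx' eq_f | f_inj]; last first.
  by rewrite big_imfset.
apply/eqP/negPn/negP => neq_xx'.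
have imD1 : [fset f z | z in S] = [fset f z | z in S `\ x].
  apply/fsetP => y; apply/imfsetP/imfsetP => -[z /= Sz ->].
    have [-> | neq_zx] := eqVneq z x; last first.
      by exists z; rewrite //= in_fsetD1 neq_zx.
    by exists x'; rewrite //= in_fsetD1 eq_sym neq_xx'.
  by exists z => //=; move: Sz; rewrite in_fsetD1 => /andP[].
have := leq_sum_imfset f w (S `\ x).
rewrite -imD1 eq_sum (big_fsetD1 x) //=.
by rewrite leqNgt -[X in X < _]add0n ltn_add2r w_gt0.
Qed.

Lemma size_pair_products s : size (pair_products s) = 'C(size s, 2).
Proof.
rewrite size_allpairs_dep -bin2_sum sumnE big_map /index_iota subn0.
by apply: eq_bigr => i _; rewrite size_iota.
Qed.

Lemma len_pre2 lam : len (pre2 lam) = 'C(len lam, 2).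
Proof. by rewrite /len /= size_sort size_pair_products. Qed.

(** Subsets of the finite type of elements of A embed, with the same
    cardinality, as finite sets of naturals; this reduces the count to
    [card_draws]. *)
Lemma card_two_subsets (A : {fset nat}) : #|` two_subsets A| = 'C(#|` A|, 2).
Proof.
rewrite [X in 'C(X, 2)]cardfE -card_draws.
pose g (Y : {set A}) : {fset nat} := [fset val y | y in Y].
have g_inj : injective g.
  by move=> X Y /fsetP eqXY; apply/setP => x; have := eqXY (val x);
     rewrite !inE.
have card_g Y : #|` g Y| = #|Y|.
  by rewrite card_imfset -?cardE //; exact: val_inj.
have -> : two_subsets A = g @` [fset Y in [set Y : {set A} | #|Y| == 2]].
  apply/fsetP => T; rewrite !inE /= fpowersetE.
  apply/andP/imfsetP => [[sTA /eqP cT] | [Y /= + ->]].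
    exists (fsub A T); last by rewrite /g fsubK.
    by rewrite !inE -card_g /g fsubK // cT.
  rewrite !inE card_g => ->; split=> //.
  by apply/fsubsetP => x /in_fset_valP[].
by rewrite card_imfset //= card_imfset //= -cardE.
Qed.

Lemma card_positions lam : #|` positions lam| = len lam.
Proof. by rewrite card_imfset //= undup_id ?iota_uniq ?size_iota. Qed.

Lemma card_marked_partitions n :
  #|` marked_partitions n| = \sum_(lam <- partitions n) 'C(len lam, 2).
Proof.
rewrite card_fset_sum1 big_imfset2 /=; last first.
  by move=> [lam T] [mu U] _ _ /= [-> ->].
apply: eq_bigr => lam _.
by rewrite -card_positions -card_two_subsets card_fset_sum1.
Qed.

Lemma A258472_sum_len_pre2 n :
  A258472 n = \sum_(lam <- P2 n) len (pre2 lam).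
Proof.
rewrite /A258472 card_marked_partitions.
rewrite (eq_bigr (fun lam => len (pre2 lam))) => [|lam _]; last by rewrite len_pre2.
rewrite [RHS](big_fset_incl _ (B := partitions n)) //.
  by apply/fsubsetP => lam; rewrite !inE => /andP[].
move=> lam; rewrite !inE /= => -> /=; rewrite -ltnNge => lt2.
by rewrite len_pre2 bin_small.
Qed.

Theorem mainTheorem4 (n : nat) :
  tau (ImP2 n) = A258472 n <-> {in P2 n &, injective pre2}.
Proof.
rewrite A258472_sum_len_pre2; apply: sum_imfset_eqP => lam.
by rewrite !inE => /andP[_ len2]; rewrite len_pre2 bin_gt0.
Qed.
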